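(* Let $k$ be a field of characteristic $p\ge 0$ with algebraic closure $\overline k$. Let $$\sigma(x)=\sum_{i=d}^{\infty}\alpha_i x^i\in\overline k((x)),$$ with $d\in\mathbb Z$ and $\alpha_i\in\overline k$ for all $i$, and let $L=k(\{\alpha_i\})\subset\overline k$ be the field generated over $k$ by the coefficients of $\sigma$. Then $\sigma(x)$ is algebraic over $k((x))$ if and only if there exists $n\in\mathbb N$ such that $[kL^{p^n}:k]<\infty$, where $kL^{p^n}$ denotes the compositum of $k$ and $L^{p^n}$ in $\overline k$.
   Context: For a field $L$ of characteristic $p>0$ and $n\in\mathbb N$, $L^{p^n}=\{f^{p^n}\mid f\in L\}$; if the characteristic is $0$, set $L^{p^n}=L$ for all $n$. $\overline k((x))$ denotes the field of formal Laurent series in $x$ with coefficients in $\overline k$. *)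

(* Defs.v *)
From HB Require Import structures.
From mathcomp Require Import all_boot all_order all_algebra.
Set Implicit Arguments. Unset Strict Implicit. Unset Printing Implicit Defensive.
Import Order.TTheory GRing.Theory Num.Theory.
Local Open Scope ring_scope.

(* A formal Laurent series  sum_{i >= 0} a i * x^(d + i)  with coefficients in R
   is represented by the pair (d, a).  Equality of Laurent series is equality
   of coefficient functions [lcoef], not of representations. *)
Definition laurent (R : Type) : Type := (int * (nat -> R))%type.

Definition lcoef (R : nzRingType) (s : laurent R) (m : int) : R :=
  if (s.1 <= m)%R then s.2 `|m - s.1|%N else 0.

Definition lzero (R : nzRingType) : laurent R := (0%R, fun _ => 0).

Definition ladd (R : nzRingType) (s t : laurent R) : laurent R :=
  let d := Order.min s.1 t.1 in
  (d, fun i => lcoef s (d + i%:Z) + lcoef t (d + i%:Z)).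

Definition lmul (R : nzRingType) (s t : laurent R) : laurent R :=
  (s.1 + t.1, fun n => \sum_(i < n.+1) s.2 i * t.2 (n - i)%N).

Definition leval (R : nzRingType) (cs : seq (laurent R)) (s : laurent R) : laurent R :=
  foldr (fun c acc => ladd c (lmul acc s)) (lzero R) cs.

Definition lmap (k K : nzRingType) (f : k -> K) (c : laurent k) : laurent K :=
  (c.1, fun i => f (c.2 i)).

Definition laurent_eq0 (R : nzRingType) (s : laurent R) : Prop :=
  forall m, lcoef s m = 0.

Definition algebraic_over_laurent (k K : fieldType) (iota : {rmorphism k -> K})
    (s : laurent K) : Prop :=
  exists cs : seq (laurent k),
    (exists j i, (nth (lzero k) cs j).2 i != 0) /\
    laurent_eq0 (leval (map (lmap iota) cs) s).

Definition field_closed (K : fieldType) (F : K -> Prop) : Prop :=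
  [/\ F 0, F 1, (forall x y, F x -> F y -> F (x - y)),
      (forall x y, F x -> F y -> F (x * y)) & (forall x, F x -> F x^-1)].

Definition gen_field (K : fieldType) (S : K -> Prop) (x : K) : Prop :=
  forall F : K -> Prop, field_closed F -> (forall y, S y -> F y) -> F x.

Definition coef_field (k K : fieldType) (iota : {rmorphism k -> K}) (a : nat -> K) : K -> Prop :=
  gen_field (fun y => (exists c, y = iota c) \/ (exists i, y = a i)).

Definition pow_set (k K : fieldType) (L : K -> Prop) (n : nat) (y : K) : Prop :=
  exists z, L z /\
    (((forall p : nat, p \in [pchar k] = false) /\ y = z) \/
     (exists p : nat, p \in [pchar k] /\ y = z ^+ (p ^ n))).

Definition compositum_pow (k K : fieldType) (iota : {rmorphism k -> K})
    (L : K -> Prop) (n : nat) : K -> Prop :=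
  gen_field (fun y => (exists c, y = iota c) \/ pow_set k L n y).

Definition finite_over (k K : fieldType) (iota : {rmorphism k -> K}) (M : K -> Prop) : Prop :=
  exists b : seq K, forall x, M x ->
    exists c : seq k, size c = size b /\
      x = \sum_(i < size b) iota (nth 0 c i) * nth 0 b i.

(* Main.v *)
(** Multiplying by powers of [x], one may work with the power series
    [A = \sum_i a_i x^i] and polynomials over [k[[x]]].

    If [A] is algebraic, take a relation [P(A^(p^n)) = 0] with [P != 0] and
    [P] of small degree: if the derivative of [P] vanishes at [A^(p^n)] it is
    either a relation of smaller degree, or zero, and then [P(y) = Q(y^p)] and
    [Q(A^(p^(n+1))) = 0].  So some [B = A^(p^n)] is a simple root of a
    polynomial, and a Newton-type recursion expresses each coefficient of [B]
    through finitely many of them.  As [B] has coefficients [a_i^(p^n)] these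
    lie in a finite extension of [k].

    Conversely, if the [a_i^(p^n)] lie in a ring that is finite over [k], then
    [A^(p^n)] acts on it through a matrix over [k[[x]]] and is a root of its
    characteristic polynomial. *)

Require Import Defs.
From HB Require Import structures.
From mathcomp Require Import all_boot all_order all_algebra.
From mathcomp Require Import boolp.
From mathcomp Require Import zify ring.
Import Order.TTheory GRing.Theory.
Local Open Scope ring_scope.
Set Implicit Arguments.
Unset Strict Implicit.
Unset Printing Implicit Defensive.

(** * Formal power series *)

Record fps (R : Type) : Type := Fps { fcoef :> nat -> R }.

HB.instance Definition _ (R : Type) := gen_eqMixin (fps R).
HB.instance Definition _ (R : Type) := gen_choiceMixin (fps R).

Lemma fpsP (R : Type) (f g : fps R) : (forall n, f n = g n) -> f = g.
Proof. by case: f g => [f] [g] /= /funext ->. Qed.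

Section FpsRing.
Variable R : comNzRingType.
Implicit Types f g h : fps R.

Definition fps_zero : fps R := Fps (fun=> 0).
Definition fps_opp f : fps R := Fps (fun n => - f n).
Definition fps_add f g : fps R := Fps (fun n => f n + g n).
Definition fps_one : fps R := Fps (fun n => (n == 0%N)%:R).
Definition fps_mul f g : fps R :=
  Fps (fun n => \sum_(i < n.+1) f i * g (n - i)%N).

Lemma fps_addA : associative fps_add.
Proof. by move=> f g h; apply: fpsP => n /=; rewrite addrA. Qed.
Lemma fps_addC : commutative fps_add.
Proof. by move=> f g; apply: fpsP => n /=; rewrite addrC. Qed.
Lemma fps_add0 : left_id fps_zero fps_add.
Proof. by move=> f; apply: fpsP => n /=; rewrite add0r. Qed.
Lemma fps_addN : left_inverse fps_zero fps_opp fps_add.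
Proof. by move=> f; apply: fpsP => n /=; rewrite addNr. Qed.

HB.instance Definition _ :=
  GRing.isZmodule.Build (fps R) fps_addA fps_addC fps_add0 fps_addN.

(** Coefficient [n] of a product or power involves only coefficients up to [n], so associativity and
    power formulas can be checked on polynomial truncations. *)
Definition ftrunc m f : {poly R} := \poly_(i < m) f i.

Lemma coef_ftrunc m f n : (n < m)%N -> (ftrunc m f)`_n = f n.
Proof. by rewrite coef_poly => ->. Qed.

Lemma fps_mulE m f g n : (n < m)%N ->
  fps_mul f g n = (ftrunc m f * ftrunc m g)`_n.
Proof.
move=> nm; rewrite coefM; apply: eq_bigr => i _.
by rewrite !coef_ftrunc //; have := ltn_ord i; lia.
Qed.

Lemma fps_mulC : commutative fps_mul.
Proof.
by move=> f g; apply: fpsP => n; rewrite !(@fps_mulE n.+1) // mulrC.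
Qed.

Lemma fps_mulA : associative fps_mul.
Proof.
move=> f g h; apply: fpsP => n; pose t := ftrunc n.+1.
transitivity ((t f * (t g * t h))`_n).
  rewrite coefM; apply: eq_bigr => i _; have := ltn_ord i => ?.
  by rewrite coef_ftrunc // (@fps_mulE n.+1) //; lia.
rewrite mulrA coefM; apply: eq_bigr => i _; have := ltn_ord i => ?.
by rewrite (@fps_mulE n.+1) // coef_ftrunc //; lia.
Qed.

Lemma fps_mul1 : left_id fps_one fps_mul.
Proof.
move=> f; apply: fpsP => n /=; rewrite big_ord_recl big1 ?addr0 ?mul1r ?subn0 //.
by move=> i _; rewrite mul0r.
Qed.

Lemma fps_mulD : left_distributive fps_mul fps_add.
Proof.
move=> f g h; apply: fpsP => n /=; rewrite -big_split /=.
by apply: eq_bigr => i _; rewrite mulrDl.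
Qed.

Lemma fps_oner_neq0 : fps_one != 0 :> fps R.
Proof. by apply/eqP => /(congr1 (@fcoef R))/(congr1 (@^~ 0%N))/eqP; rewrite oner_eq0. Qed.

HB.instance Definition _ := GRing.Zmodule_isComNzRing.Build (fps R)
  fps_mulA fps_mulC fps_mul1 fps_mulD fps_oner_neq0.

Lemma fcoefD f g n : (f + g) n = f n + g n. Proof. by []. Qed.
Lemma fcoefN f n : (- f) n = - f n. Proof. by []. Qed.
Lemma fcoefM f g n : (f * g) n = \sum_(i < n.+1) f i * g (n - i)%N.
Proof. by []. Qed.
Lemma fcoef_sum (I : Type) (r : seq I) (P : pred I) (F : I -> fps R) n :
  (\sum_(i <- r | P i) F i) n = \sum_(i <- r | P i) F i n.
Proof. by elim/big_rec2: _ => //= i y x _ <-. Qed.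

Lemma fcoefMn f m n : (f *+ m) n = f n *+ m.
Proof. by elim: m => // m IH; rewrite !mulrS fcoefD IH. Qed.

Lemma fcoef_exp m f q n : (n < m)%N -> (f ^+ q) n = (ftrunc m f ^+ q)`_n.
Proof.
elim: q n => [|q IH] n nm; first by rewrite !expr0 coef1.
rewrite !exprS fcoefM coefM; apply: eq_bigr => i _; have := ltn_ord i => ?.
by rewrite coef_ftrunc ?IH //; lia.
Qed.

Definition fXn m : fps R := Fps (fun n => (n == m)%:R).

Lemma fcoefXnM m f n : (fXn m * f) n = if (m <= n)%N then f (n - m)%N else 0.
Proof.
rewrite fcoefM; case: ifP => mn.
  have mn1 : (m < n.+1)%N by lia.
  rewrite (bigD1 (Ordinal mn1)) //= eqxx mul1r big1 ?addr0 // => i.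
  by rewrite -val_eqE /= => /negPf ->; rewrite mul0r.
rewrite big1 // => i _; have := ltn_ord i => ? /=.
by rewrite (_ : (i == m :> nat) = false) ?mul0r //; lia.
Qed.

Lemma fcoefXnMD m f n : (fXn m * f) (m + n)%N = f n.
Proof. by rewrite fcoefXnM leq_addr addKn. Qed.

Lemma fXnM m n : fXn m * fXn n = fXn (m + n)%N.
Proof.
apply: fpsP => i; rewrite fcoefXnM /=; case: ifP => h; last first.
  by rewrite (_ : (i == _) = false) //; lia.
by congr (_%:R); congr nat_of_bool; lia.
Qed.

Lemma fXnI m : injective ( *%R (fXn m)).
Proof. by move=> f g e; apply: fpsP => n; rewrite -(fcoefXnMD m f) e fcoefXnMD. Qed.

Lemma fXn_dvd m f : (forall i, (i < m)%N -> f i = 0) ->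
  f = fXn m * Fps (fun i => f (m + i)%N).
Proof.
move=> h; apply: fpsP => n; rewrite fcoefXnM /=.
by case: leqP => [le|/h //]; rewrite subnKC.
Qed.

(** For such [q], possibly [1], the power map is additive on the truncated polynomial, so [f ^+ q]
    is the sum of the [f i ^+ q] times [x^(i q)]. *)
Lemma fcoef_frobenius q f n : (0 < q)%N -> [pchar R].-nat q ->
  (f ^+ q) n = if (q %| n)%N then f (n %/ q)%N ^+ q else 0.
Proof.
move=> q0 qR; have qP : [pchar {poly R}].-nat q.
  by rewrite (eq_pnat _ (@pchar_poly R)).
rewrite (@fcoef_exp n.+1) // /ftrunc poly_def.
rewrite (big_morph (fun P : {poly R} => P ^+ q) (id1 := 0) (op1 := +%R)); first last.
- by rewrite expr0n; case: q q0 {qR qP}.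
- by move=> x y; rewrite exprDn_pchar.
rewrite coef_sum; under eq_bigr => i _ do rewrite exprZn -exprM coefZ coefXn.
case: ifP => [/dvdnP[m ->]|qn].
  have h : (m < (m * q).+1)%N by nia.
  rewrite (bigD1 (Ordinal h)) //= mulnK // eqxx mulr1 big1 ?addr0 // => i.
  rewrite -val_eqE /= => im; rewrite (_ : (_ == _) = false) ?mulr0 //.
  by rewrite eqn_pmul2r // eq_sym; apply/negbTE.
rewrite big1 // => i _; rewrite (_ : (_ == _) = false) ?mulr0 //.
by apply/eqP => e; rewrite e dvdn_mull in qn.
Qed.

End FpsRing.

Arguments fXn {R}.

Section FpsMap.
Variables (R S : comNzRingType) (phi : {rmorphism R -> S}).

Definition fmap (f : fps R) : fps S := Fps (fun n => phi (f n)).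

Lemma fmap_is_zmod_morphism : zmod_morphism fmap.
Proof. by move=> f g; apply: fpsP => n /=; rewrite -rmorphB. Qed.

Lemma fmap_is_monoid_morphism : monoid_morphism fmap.
Proof.
split=> [|f g]; apply: fpsP => n /=; first by rewrite rmorph_nat.
by rewrite rmorph_sum; apply: eq_bigr => i _; rewrite rmorphM.
Qed.

HB.instance Definition _ := GRing.isZmodMorphism.Build (fps R) (fps S) fmap
  fmap_is_zmod_morphism.
HB.instance Definition _ := GRing.isMonoidMorphism.Build (fps R) (fps S) fmap
  fmap_is_monoid_morphism.

Lemma fmap_fXn m : fmap (fXn m) = fXn m.
Proof. by apply: fpsP => n /=; rewrite rmorph_nat. Qed.

End FpsMap.

Lemma fmap_inj (k K : fieldType) (iota : {rmorphism k -> K}) : injective (fmap iota).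
Proof.
move=> f g /(congr1 (@fcoef _)) e; apply: fpsP => n.
by have /(congr1 (@^~ n))/= /fmorph_inj := e.
Qed.

(** * Finite extensions *)

Section FiniteExtension.
Variables (k K : fieldType) (iota : {rmorphism k -> K}).
Implicit Types (b : seq K) (x y : K).

(** Only the values [c i] with [i < size b] count; this avoids the size condition of
    [finite_over]. *)
Definition kspan b x : Prop :=
  exists c : nat -> k, x = \sum_(i < size b) iota (c i) * b`_i.

Lemma kspan0 b : kspan b 0.
Proof. by exists (fun=> 0); rewrite big1 // => i _; rewrite rmorph0 mul0r. Qed.

Lemma kspanD b x y : kspan b x -> kspan b y -> kspan b (x + y).
Proof.
move=> [c ->] [c' ->]; exists (fun i => c i + c' i).
by rewrite -big_split; apply: eq_bigr => i _; rewrite rmorphD mulrDl.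
Qed.

Lemma kspanZ b c x : kspan b x -> kspan b (iota c * x).
Proof.
move=> [e ->]; exists (fun i => c * e i).
by rewrite mulr_sumr; apply: eq_bigr => i _; rewrite rmorphM mulrA.
Qed.

Lemma kspan_sum b (I : Type) (r : seq I) (P : pred I) (F : I -> K) :
  (forall i, P i -> kspan b (F i)) -> kspan b (\sum_(i <- r | P i) F i).
Proof.
by move=> h; elim/big_ind: _ => //; [exact: kspan0 | move=> x y; exact: kspanD].
Qed.

Lemma kspan_mem b x : x \in b -> kspan b x.
Proof.
move=> xb; exists (fun i => (i == index x b)%:R).
rewrite -index_mem in xb; rewrite (bigD1 (Ordinal xb)) //= eqxx rmorph1 mul1r.
rewrite nth_index -?index_mem // big1 ?addr0 // => i.
by rewrite -val_eqE /= => /negPf ->; rewrite rmorph0 mul0r.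
Qed.

Lemma kspan_ind b (W : K -> Prop) : W 0 -> (forall x y, W x -> W y -> W (x + y)) ->
  (forall c x, W x -> W (iota c * x)) -> (forall x, x \in b -> W x) ->
  forall x, kspan b x -> W x.
Proof.
move=> W0 WD WZ Wb x [c ->]; elim/big_ind: _ => // i _.
by apply/WZ/Wb/mem_nth.
Qed.

Lemma kspan_mulW b b' (W : K -> Prop) :
  W 0 -> (forall x y, W x -> W y -> W (x + y)) ->
  (forall c x, W x -> W (iota c * x)) ->
  (forall x y, x \in b -> y \in b' -> W (x * y)) ->
  forall x y, kspan b x -> kspan b' y -> W (x * y).
Proof.
move=> W0 WD WZ Wb x y bx b'y.
elim/kspan_ind: bx => [|u v|c u|u ub]; rewrite ?mul0r ?mulrDl -?mulrA;
  [by []|exact: WD|exact: WZ|].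
elim/kspan_ind: b'y => [|w v|c w|w wb]; rewrite ?mulr0 ?mulrDr 1?mulrCA;
  [by []|exact: WD|exact: WZ|].
by apply: Wb; rewrite // mulrC.
Qed.

Lemma kspan_allpairs b b' x y : kspan b x -> kspan b' y ->
  kspan [seq u * v | u <- b, v <- b'] (x * y).
Proof.
apply: kspan_mulW => [|u v|c u|u v ub vb]; [exact: kspan0|exact: kspanD|exact: kspanZ|].
exact/kspan_mem/allpairs_f.
Qed.

Definition kspan_ring b : Prop :=
  kspan b 1 /\ forall x y, kspan b x -> kspan b y -> kspan b (x * y).

Lemma kspan_ring_iota b c : kspan_ring b -> kspan b (iota c).
Proof. by case=> b1 _; rewrite -[iota c]mulr1; apply: kspanZ. Qed.

Lemma kspan_ring_allpairs b b' : kspan_ring b -> kspan_ring b' ->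
  kspan_ring [seq u * v | u <- b, v <- b'].
Proof.
move=> [b1 bM] [b'1 b'M]; split; first by rewrite -[1]mulr1; apply: kspan_allpairs.
apply: kspan_mulW => [|u v|c u|u v]; [exact: kspan0|exact: kspanD|exact: kspanZ|].
move=> /allpairsP[[x y] /= [xb yb ->]] /allpairsP[[x' y'] /= [x'b y'b ->]].
by rewrite mulrACA; apply: kspan_allpairs; [apply: bM|apply: b'M]; exact: kspan_mem.
Qed.

Definition powers m y := [seq y ^+ i | i <- seq.iota 0 m].

Hypothesis Kalg : forall x : K, exists q : {poly k}, q != 0 /\ root (map_poly iota q) x.

(** Division by a relation [q] of [y] reduces every power of [y] to a combination of powers below
    [size q], so products of generators stay in the span. *)
Lemma kspan_ring_powers y : exists m, kspan_ring (powers m.+1 y) /\ kspan (powers m.+1 y) y.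
Proof.
have [q [q0 qy]] := Kalg y; exists (size q); set b := powers _ _.
have bX i : kspan b (y ^+ i).
  have -> : y ^+ i = (map_poly iota ('X^i %% q)).[y].
    have /(congr1 (fun P => (map_poly iota P).[y])) := divp_eq 'X^i q.
    rewrite rmorphD rmorphM !hornerE /= (rootP qy) mulr0 add0r.
    by rewrite map_polyXn hornerXn.
  rewrite horner_poly; apply: kspan_sum => j _.
  apply/kspanZ/kspan_mem/map_f; rewrite mem_iota /=.
  rewrite add0n ltnS; apply/ltnW/(leq_trans (ltn_ord j)).
  by rewrite ltnW ?ltn_modp.
split; last exact: (bX 1%N).
split; first exact: (bX 0%N).
apply: kspan_mulW => [|u v|c u|u v]; [exact: kspan0|exact: kspanD|exact: kspanZ|].
by move=> /mapP[i _ ->] /mapP[j _ ->]; rewrite -exprD.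
Qed.

(** Elements are adjoined one at a time, multiplying the two spanning families at each stage. *)
Lemma kspan_ring_adjoin (g : seq K) :
  exists b, kspan_ring b /\ forall x, x \in g -> kspan b x.
Proof.
elim: g => [|y g [b [br bg]]].
  exists [:: 1]; split=> //; split; first by apply: kspan_mem; rewrite mem_head.
  apply: kspan_mulW => [|u v|c u|u v]; [exact: kspan0|exact: kspanD|exact: kspanZ|].
  by rewrite !inE => /eqP -> /eqP ->; rewrite mulr1; apply: kspan_mem; rewrite mem_head.
have [m [yr yy]] := kspan_ring_powers y.
exists [seq u * v | u <- b, v <- powers m.+1 y]; split; first exact: kspan_ring_allpairs.
move=> x; rewrite inE => /orP[/eqP ->|/bg xb].
  by rewrite -[X in kspan _ X]mul1r; apply: kspan_allpairs yy; exact: br.1.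
by rewrite -[X in kspan _ X]mulr1; apply: kspan_allpairs xb _; exact: yr.1.
Qed.

Lemma kspan_ring_exp b x n : kspan_ring b -> kspan b x -> kspan b (x ^+ n).
Proof.
move=> [b1 bM] bx; elim: n => [|n IH]; first by rewrite expr0.
by rewrite exprS; apply: bM.
Qed.

Lemma kspan_ring_horner b x (P : {poly k}) : kspan_ring b -> kspan b x ->
  kspan b (map_poly iota P).[x].
Proof.
move=> br bx; rewrite horner_coef; apply: kspan_sum => i _.
by rewrite coef_map; apply/kspanZ/kspan_ring_exp.
Qed.

(* If [x != 0] is algebraic, cancelling powers of [x] gives a relation
   [c + x * P(x) = 0] with [c != 0], so [x^-1 = - P(x) / c]. *)
Lemma kspan_ring_inv b x : kspan_ring b -> kspan b x -> kspan b x^-1.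
Proof.
move=> br bx; have [->|x0] := eqVneq x 0; first by rewrite invr0; apply: kspan0.
have [q [q0 qx]] := Kalg x; move: qx.
elim/poly_ind: q q0 => [|P c IH]; first by rewrite eqxx.
have [->|c0] := eqVneq c 0.
  rewrite addr0 mulf_eq0 polyX_eq0 orbF => /IH {}IH.
  by rewrite rmorphM rootM /= map_polyX rootX (negPf x0) orbF => /IH.
move=> _; rewrite /root rmorphD rmorphM /= map_polyX map_polyC !hornerE => /eqP e.
have -> : x^-1 = iota (- c^-1) * (map_poly iota P).[x].
  have ic0 : iota c != 0 by rewrite fmorph_eq0.
  apply: (mulfI x0); rewrite divff // rmorphN fmorphV mulrCA (mulrC x).
  by rewrite (eqP (_ : _ * x == - iota c)) ?mulrNN ?mulVf // -addr_eq0 e.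
exact/kspanZ/kspan_ring_horner.
Qed.

(** This lets a finite span serve as the test field [F] in [gen_field]. *)
Lemma kspan_field_closed b : kspan_ring b -> field_closed (kspan b).
Proof.
move=> br; split; [exact: kspan0|exact: br.1| |exact: br.2|]; last first.
  by move=> x; apply: kspan_ring_inv.
move=> x y bx by_; apply: kspanD => //.
by rewrite -[y]mul1r -mulNr -(rmorph1 iota) -rmorphN; apply: kspanZ.
Qed.

Lemma finite_overP (M : K -> Prop) :
  finite_over iota M <-> exists b, forall x, M x -> kspan b x.
Proof.
split=> -[b h]; exists b => x /h.
  by move=> [c [_ ->]]; exists (fun i => c`_i).
move=> [c ->]; exists (mkseq c (size b)); rewrite size_mkseq; split=> //.
by apply: eq_bigr => i _; rewrite nth_mkseq.
Qed.

End FiniteExtension.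

(** * Laurent series and power series *)

(* The shift by [x ^ s.1] is forgotten. *)
Definition lfps (R : Type) (s : laurent R) : fps R := Fps s.2.

Lemma laurent_eq0P (R : nzRingType) (s : laurent R) :
  laurent_eq0 s <-> forall i, s.2 i = 0.
Proof.
split=> [h i|h m]; last by rewrite /lcoef h; case: ifP.
have := h (s.1 + i%:Z); rewrite /lcoef addrAC subrr add0r absz_nat.
by rewrite (_ : (s.1 <= s.1 + i%:Z)%R = true) //; lia.
Qed.

Section LaurentFps.
Variable R : comNzRingType.
Implicit Types s t : laurent R.

Lemma laurent_eq0_lfps s : laurent_eq0 s <-> lfps s = 0.
Proof.
rewrite laurent_eq0P; split=> [h|/(congr1 (@fcoef R)) e i]; first exact: fpsP.
by have /(congr1 (@^~ i)) := e.
Qed.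

Lemma lfps_mul s t : lfps (lmul s t) = lfps s * lfps t.
Proof. exact: fpsP. Qed.

Lemma lcoef_shift s (e : int) i : (e <= s.1)%R ->
  lcoef s (e + i%:Z) = (fXn `|s.1 - e|%N * lfps s) i.
Proof.
move=> es; rewrite fcoefXnM /lcoef /=.
have -> : (s.1 <= e + i%:Z)%R = (`|s.1 - e| <= i)%N by lia.
by case: ifP => // h; congr (s.2 _); lia.
Qed.

Lemma lfps_add s t : exists e : int,
  [/\ (e <= s.1)%R, (e <= t.1)%R, (ladd s t).1 = e
    & lfps (ladd s t) = fXn `|s.1 - e|%N * lfps s + fXn `|t.1 - e|%N * lfps t].
Proof.
have [le1 le2] : (Order.min s.1 t.1 <= s.1)%R /\ (Order.min s.1 t.1 <= t.1)%R.
  by rewrite !ge_min !lexx orbT.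
exists (Order.min s.1 t.1); split=> //; apply: fpsP => i.
by rewrite fcoefD /= !lcoef_shift.
Qed.

End LaurentFps.

Section Eval.
Variables (k K : fieldType) (iota : {rmorphism k -> K}) (d : int) (a : nat -> K).

(** Each Horner step multiplies the partial value and the new coefficient by powers of [x], which
    the coefficients of [P] absorb. *)
Lemma leval_poly (cs : seq (laurent k)) : exists P : {poly fps k},
  lfps (leval (map (lmap iota) cs) (d, a)) = (map_poly (fmap iota) P).[Fps a] /\
  ((exists j i, (nth (lzero k) cs j).2 i != 0) -> P != 0).
Proof.
elim: cs => [|c cs [P [Pa P0]]] /=.
  exists 0; rewrite rmorph0 horner0; split; first exact: fpsP.
  by move=> [j [i /eqP]]; rewrite nth_nil.
have [e [_ _ _ ->]] := lfps_add (lmap iota c)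
  (lmul (leval (map (lmap iota) cs) (d, a)) (d, a)).
rewrite lfps_mul Pa; set u := absz _; set v := absz _.
exists (P * (fXn v)%:P * 'X + (fXn u * lfps c)%:P); split.
  rewrite rmorphD !rmorphM /= map_polyX !map_polyC /= !hornerE /= !fmap_fXn.
  rewrite addrC; congr (_ + _); first by rewrite [in RHS](mulrC _ (fXn v)).
(* The constant coefficient is [x^u c] and the others are [x^v] times those of [P]; cancelling these
   powers of [x] preserves nonvanishing. *)
move=> nz; apply/eqP => /(congr1 (fun p : {poly fps k} => nth 0 p)) eP.
case: nz => -[|j] [i /eqP ci].
  have := congr1 (@^~ 0%N) eP; rewrite /= coefD coefMX coefC add0r coef0.
  rewrite -[RHS](mulr0 (fXn u)) => /fXnI /(congr1 (@fcoef k)) /(congr1 (@^~ i)).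
  exact: ci.
have /eqP[] : P != 0 by apply: P0; exists j, i; apply/eqP.
apply/polyP => n; have := congr1 (@^~ n.+1) eP.
rewrite /= coefD coefMX coefC addr0 coefMC !coef0 mulrC -[RHS](mulr0 (fXn v)).
exact: fXnI.
Qed.

Fixpoint twist (e : int) (Q : seq (fps k)) : seq (laurent k) :=
  if Q is q :: Q' then (e, q : nat -> k) :: twist (e - d) Q' else [::].

Lemma nth_twist e Q j : (nth (lzero k) (twist e Q) j).2 =1 Q`_j.
Proof. by elim: Q e j => [|q Q IH] e [|j] i //=; rewrite ?nth_nil ?IH. Qed.

(* Up to powers of [x], evaluating [\sum_j x^(e - j d) Q_j y^j] at
   [y = x^d A] yields [x^e \sum_j Q_j A^j]. *)
Lemma leval_twist (e : int) (Q : seq (fps k)) : exists i j : nat,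
  let s := leval (map (lmap iota) (twist e Q)) (d, a) in
  s.1 + j%:Z = e + i%:Z /\
  fXn i * lfps s = fXn j * horner_rec (map (fmap iota) Q) (Fps a).
Proof.
elim: Q e => [|q Q IH] e /=.
  (* The empty sum has order [0] and value [0], so any naturals with [j = e + i] will do. *)
  exists `|e|%N, `|(e + `|e|%N%:Z)%R|%N; split; first by rewrite add0r; lia.
  by rewrite (_ : lfps _ = 0) ?mulr0 //; apply: fpsP.
have [i [j]] := IH (e - d); case: (leval _ _) => ds sa /= [dE sE].
have [m [le1 le2 mE AE]] := lfps_add (lmap iota (e, q : nat -> k)) (lmul (ds, sa) (d, a)).
rewrite /= in le1 le2.
exists i, `|(e - m + i%:Z)%R|%N; split; first by rewrite [X in X + _]mE; lia.
(* The new shift is split in two ways: one matches the term [q], the other brings in the induction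
   hypothesis. *)
have Ju : fXn `|(e - m + i%:Z)%R|%N = fXn i * fXn `|(e - m)%R|%N :> fps K.
  by rewrite fXnM; congr fXn; lia.
have Jv : fXn `|(e - m + i%:Z)%R|%N = fXn `|(ds + d - m)%R|%N * fXn j :> fps K.
  by rewrite fXnM; congr fXn; lia.
rewrite [X in _ * X]AE lfps_mul.
rewrite [RHS]mulrDr [LHS]mulrDr [LHS]addrC; congr (_ + _).
  by rewrite Jv mulrCA [X in _ * X]mulrA sE -!mulrA.
by rewrite Ju -mulrA.
Qed.

Lemma algebraic_over_laurentP : algebraic_over_laurent iota (d, a) <->
  exists2 P : {poly fps k}, P != 0 & root (map_poly (fmap iota) P) (Fps a).
Proof.
split=> [[cs [cs0 /laurent_eq0_lfps e]]|[P P0 Pa]].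
  have [P [Pa /(_ cs0) P0]] := leval_poly cs.
  by exists P => //; apply/rootP; rewrite -Pa e.
exists (twist 0 P); split.
  exists (size P).-1; apply/not_existsP => h.
  have /eqP[] : lead_coef P != 0 by rewrite lead_coef_eq0.
  apply: fpsP => i; apply/eqP; rewrite -[_ == _]negbK; apply/negP => ci.
  by apply: (h i); rewrite nth_twist.
apply/laurent_eq0_lfps.
have [i [j [_]]] := leval_twist 0 P.
rewrite -horner_Poly -map_polyE (rootP Pa).
by rewrite mulr0 -[RHS](mulr0 (fXn i)) => /fXnI.
Qed.

End Eval.

(** * Coefficients of algebraic power series *)

Section FieldClosed.
Variables (K : fieldType) (F : K -> Prop).
Hypothesis FF : field_closed F.

Lemma field_closedN x : F x -> F (- x).
Proof. by case: FF => F0 _ FB _ _ Fx; rewrite -sub0r; apply: FB. Qed.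

Lemma field_closedD x y : F x -> F y -> F (x + y).
Proof.
move=> Fx /field_closedN Fy; rewrite -[y]opprK.
by case: FF => _ _ FB _ _; apply: FB.
Qed.

Lemma field_closed_sum (I : Type) (r : seq I) (P : pred I) (E : I -> K) :
  (forall i, P i -> F (E i)) -> F (\sum_(i <- r | P i) E i).
Proof.
by move=> h; elim/big_ind: _ => //; [case: FF | move=> x y; apply: field_closedD].
Qed.

End FieldClosed.

Lemma fcoef_horner_closed (k K : fieldType) (iota : {rmorphism k -> K})
    (F : K -> Prop) (P : {poly fps k}) (f : fps K) :
  field_closed F -> (forall c, F (iota c)) -> (forall n, F (f n)) ->
  forall n, F ((map_poly (fmap iota) P).[f] n).
Proof.
move=> FF Fk Ff; elim/poly_ind: P => [|P c IH] n.
  by rewrite rmorph0 horner0; case: FF.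
rewrite rmorphD rmorphM /= map_polyX map_polyC !hornerE fcoefD.
apply: field_closedD => //; last exact: Fk.
by rewrite fcoefM; apply: field_closed_sum => // i _; case: FF => _ _ _ FM _; apply: FM.
Qed.

(** Leaving the remainder [r] unspecified avoids factorials, so the expansion holds in every
    characteristic. *)
Lemma horner_taylor1 (R : comNzRingType) (P : {poly R}) (x h : R) :
  exists r, P.[x + h] = P.[x] + P^`().[x] * h + h ^+ 2 * r.
Proof.
elim/poly_ind: P => [|P c [r IH]].
  by exists 0; rewrite deriv0 !horner0; ring.
exists (r * (x + h) + P^`().[x]).
rewrite derivD derivM derivC derivX addr0 mulr1 !hornerE IH; ring.
Qed.

Section Separable.
Variables (k K : fieldType) (iota : {rmorphism k -> K}).

(* With [e] the order of [P'(B)] and [s] the truncation of [B] at [N > e],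
   [P(s) = P'(B) (s - B) + (s - B)^2 r] and the coefficient of [x^(N + e)]
   expresses [B N] through [B 0, ..., B (N - 1)] and the leading coefficient
   of [P'(B)]. *)
Lemma separable_root_coef (P : {poly fps k}) (B : fps K) :
    root (map_poly (fmap iota) P) B ->
    ~~ root (map_poly (fmap iota) P)^`() B ->
  exists g : seq K, forall F : K -> Prop, field_closed F ->
    (forall c, F (iota c)) -> (forall x, x \in g -> F x) -> forall i, F (B i).
Proof.
set Q := map_poly _ P => QB; rewrite rootE; set D := Q^`().[B] => D0.
have ex : exists e, D e != 0.
  apply/not_existsP => h; case/eqP: D0; apply: fpsP => i.
  by apply/eqP; rewrite -[_ == _]negbK; apply/negP/h.
case: (ex_minnP ex) => e De mine.
(* The recursion divides by [D e] and starts after [B e]. *)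
exists (D e :: [seq B i | i <- seq.iota 0 e.+1]) => F FF Fk Fg N.
have [FDe FB] : F (D e) /\ forall i, (i <= e)%N -> F (B i).
  split=> [|i ie]; apply: Fg; rewrite inE ?eqxx // map_f ?orbT //.
  by rewrite mem_iota.
have [F0 _ _ FM FV] := FF.
elim/ltn_ind: N => N IH; have [/FB //|eN] := leqP N e.
pose s : fps K := Fps (fun i => if (i < N)%N then B i else 0).
have Fs n : F (s n) by rewrite /s /=; case: ifP => // /IH.
have [r] := horner_taylor1 Q B (s - B).
rewrite addrC subrK (rootP QB) add0r -/D.
pose t : fps K := Fps (fun i => (s - B) (N + i)%N).
have -> : s - B = fXn N * t.
  by apply: fXn_dvd => i iN; rewrite fcoefD fcoefN /= iN subrr.
have -> : D = fXn e * Fps (fun i => D (e + i)%N).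
  apply: fXn_dvd => i ie; apply/eqP; apply: contraTT ie => /mine.
  by rewrite -leqNgt.
set D' := Fps _ => Qs.
have {Qs} : Q.[s] (N + e)%N = - (D e * B N).
  (* Since [N > e], the quadratic term, divisible by [x^(2N)], does not reach the coefficient of
     [x^(N + e)]. *)
  have -> : Q.[s] = fXn (N + e)%N * (D' * t + fXn (N - e)%N * (t ^+ 2 * r)).
    rewrite Qs mulrDr -fXnM.
    have -> : fXn N = fXn e * fXn (N - e)%N :> fps K by rewrite fXnM subnKC // ltnW.
    by ring.
  rewrite -{2}[(N + e)%N]addn0 fcoefXnMD fcoefD fcoefXnM.
  rewrite (_ : (N - e <= 0)%N = false) ?addr0; last by lia.
  by rewrite fcoefM big_ord1 /= !addn0 ltnn sub0r mulrN.
(* The coefficient of [Q.[s]] lies in [F] because [s] only involves the [B i] with [i < N]. *)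
move=> e1; have -> : B N = - Q.[s] (N + e)%N * (D e)^-1.
  by rewrite e1 opprK mulrAC mulfV // mul1r.
apply: FM; last exact: FV.
by apply: field_closedN => //; apply: fcoef_horner_closed.
Qed.

(* [p] is the characteristic exponent of [k], so [p = 1] in characteristic 0. *)
Variable p : nat.
Hypothesis p_gt0 : (0 < p)%N.
Hypothesis pP : forall m, (0 < m)%N -> m%:R = 0 :> k -> (1 < p)%N && (p %| m)%N.

(** From [i * P_i = 0] for all [i], only exponents divisible by [p] survive; the leading one is
    positive, which forces [p > 1]. *)
Lemma deriv_eq0_comp_Xp (P : {poly fps k}) : (1 < size P)%N -> P^`() = 0 ->
  exists Q : {poly fps k}, [/\ (size Q < size P)%N & P = Q \Po 'X^p].
Proof.
move=> sP P'0.
have Pi i : (0 < i)%N -> P`_i != 0 -> (1 < p)%N && (p %| i)%N.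
  case: i => // i _ /eqP Pi; apply: pP => //; apply/eqP/negPn/negP => i0; apply: Pi.
  apply: fpsP => n; have := congr1 (fun R : {poly fps k} => R`_i n) P'0.
  rewrite coef_deriv coef0 fcoefMn -mulr_natr => /eqP.
  by rewrite mulf_eq0 (negPf i0) orbF => /eqP.
have p1 : (1 < p)%N.
  have s1 : (0 < (size P).-1)%N by lia.
  have lP : P`_(size P).-1 != 0.
    by rewrite -lead_coefE lead_coef_eq0 -size_poly_gt0; lia.
  by case/andP: (Pi _ s1 lP).
(* This bound suffices: if [i >= (size P).-1] then [i * p >= size P], as [p] and [size P] are at
   least [2]. *)
exists (\poly_(i < (size P).-1) P`_(i * p)); split.
  by rewrite (leq_ltn_trans (size_poly _ _)) //; lia.
apply/polyP => i; rewrite coef_comp_poly_Xn // coef_poly.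
case: ifP => [pi|/negbT pi].
  rewrite divnK //; case: ifP => // /negbT; rewrite -leqNgt => h.
  rewrite nth_default // -(divnK pi); apply: leq_trans (leq_mul h p1).
  by case: (size P) sP => [|[|s]] // _; rewrite /= muln2; lia.
have i0 : (0 < i)%N by rewrite lt0n; apply: contraNneq pi => ->.
by apply/eqP; apply: contraNT pi => /(Pi _ i0)/andP[].
Qed.

(** Induction on the size of [P]: passing to the derivative, or to [Q] with [P = Q \Po 'X^p], lowers
    it, and the latter raises [n] by one. *)
Lemma separable_frobenius_root (A : fps K) n (P : {poly fps k}) : P != 0 ->
    root (map_poly (fmap iota) P) (A ^+ (p ^ n)) ->
  exists n' (P' : {poly fps k}),
    root (map_poly (fmap iota) P') (A ^+ (p ^ n')) /\
    ~~ root (map_poly (fmap iota) P')^`() (A ^+ (p ^ n')).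
Proof.
have [s] := ubnP (size P); elim: s n P => // s IH n P sP P0 PA.
have [P'A|] := boolP (root (map_poly (fmap iota) P)^`() (A ^+ (p ^ n))); last by exists n, P.
have P1 : (1 < size P)%N.
  rewrite ltnNge; apply: contra_neqN P0 => /size1_polyC P1.
  move: PA; rewrite P1 map_polyC rootC -(rmorph0 (fmap iota)) (inj_eq (@fmap_inj _ _ iota)).
  by move=> /eqP ->.
have [P'0|P'0] := eqVneq P^`() 0.
  have [Q [sQ PQ]] := deriv_eq0_comp_Xp P1 P'0.
  apply: (IH n.+1 Q); first by lia.
    by apply: contra_neq P0 => Q0; rewrite PQ Q0 comp_poly0.
  move: PA; rewrite PQ map_comp_poly /= map_polyXn /root horner_comp hornerXn.
  by rewrite -exprM -expnSr.
apply: (IH n P^`()) => //; last by rewrite -deriv_map.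
by have := lt_size_deriv P0; lia.
Qed.

End Separable.

(** * Power series with coefficients in a finite ring extension *)

Section Integral.
Variables (k K : fieldType) (iota : {rmorphism k -> K}).

Definition fconst (c : K) : fps K := Fps (fun n => if n == 0%N then c else 0).

Lemma fcoefMconst (f : fps K) c n : (f * fconst c) n = f n * c.
Proof.
rewrite fcoefM big_ord_recr /= subnn eqxx big1 ?add0r // => i _.
by rewrite (_ : (n - i == 0)%N = false) ?mulr0 //; have := ltn_ord i; lia.
Qed.

(* [f] acts on [b] through a matrix [T] over [k[[x]]], hence is a root of the
   characteristic polynomial of [T]. *)
Lemma kspan_ring_integral b (f : fps K) : kspan_ring iota b ->
  (forall n, kspan iota b (f n)) ->
  exists P : {poly fps k}, P != 0 /\ root (map_poly (fmap iota) P) f.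
Proof.
move=> [b1 bM] bf; set m := size b.
have /choice[t tE] (ij : nat * 'I_m) : exists c : nat -> k,
    f ij.1 * b`_ij.2 = \sum_(l < m) iota (c l) * b`_l.
  by apply: bM => //; apply/kspan_mem/mem_nth.
pose T : 'M[fps k]_m := \matrix_(j, l) Fps (fun i => t (i, j) l).
exists (char_poly T); split; first by rewrite monic_neq0 ?char_poly_monic.
pose T' := map_mx (fmap iota) T; pose N : 'M[fps K]_m := f%:M - T'.
rewrite map_char_poly rootE /char_poly -horner_evalE -det_map_mx.
have -> : map_mx (horner_eval f) (char_poly_mx T') = N.
  apply/matrixP => i j; rewrite !mxE /horner_eval hornerD hornerN hornerMn.
  by rewrite hornerX !hornerC.
pose v : 'cV[fps K]_m := \col_j fconst b`_j.
have Nv : N *m v = 0.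
  apply/matrixP => j z; rewrite mulmxBl mul_scalar_mx !mxE.
  apply: fpsP => n; rewrite fcoefD fcoefN fcoefMconst (tE (n, j)) fcoef_sum.
  by apply/eqP; rewrite subr_eq0; apply/eqP/eq_bigr => l _; rewrite !mxE fcoefMconst.
(* Multiplying [N *m v = 0] by the adjugate shows that [\det N] kills every [b_j]. *)
have dv j : \det N * fconst b`_(j : 'I_m) = 0.
  have /matrixP/(_ j 0) : \det N *: v = 0.
    by rewrite -mul_scalar_mx -mul_adj_mx -mulmxA Nv mulmx0.
  by rewrite !mxE.
apply/eqP/fpsP => n; rewrite -[LHS]mulr1; case: b1 => c ->.
(* As [1] is a combination of the [b_j], [\det N] itself vanishes. *)
rewrite mulr_sumr big1 // => j _.
rewrite mulrCA -fcoefMconst dv ?mulr0 //.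
Qed.

End Integral.

(** * Characteristic exponent and proof of the equivalence *)

Lemma pow_setP (k K : fieldType) : exists p : nat,
  [/\ (0 < p)%N, [pchar k].-nat p,
    (forall m, (0 < m)%N -> m%:R = 0 :> k -> (1 < p)%N && (p %| m)%N) &
    forall (L : K -> Prop) n y, pow_set k L n y <-> exists2 z, L z & y = z ^+ (p ^ n)].
Proof.
have [[p pk]|k0] := pselect (exists p, p \in [pchar k]).
  have p_pr := pcharf_prime pk.
  exists p; split; [exact: prime_gt0|by rewrite pnatE| |].
    by move=> m _ /eqP; rewrite -(dvdn_pcharf pk) prime_gt1.
  move=> L n y; split=> [[z [Lz [[nop]|[r [rk ->]]]]]|[z Lz ->]].
  - by rewrite nop in pk.
  - by exists z => //; move: rk; rewrite (pcharf_eq pk) => /eqP ->.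
  - by exists z; split=> //; right; exists p.
have {}k0 p : (p \in [pchar k]) = false by apply/negP => pk; apply: k0; exists p.
(* With exponent [1] every [p ^ n] is [1], in accordance with the convention for characteristic
   [0]. *)
exists 1%N; split=> //.
  by move=> m m0 /eqP; rewrite (pcharf0P k).1 // => /eqP m_0; rewrite m_0 in m0.
move=> L n y; rewrite exp1n; split=> [[z [Lz [[_ ->]|[p []]]]]|[z Lz ->]].
- by exists z; rewrite ?expr1.
- by rewrite k0.
- by exists z; split=> //; left; rewrite expr1.
Qed.

Lemma gen_field_in (K : fieldType) (S : K -> Prop) x : S x -> gen_field S x.
Proof. by move=> Sx F _; apply. Qed.

(** The [q]-th power map is a field endomorphism, so preimages of subfields are subfields. *)
Lemma field_closed_root (K : fieldType) (F : K -> Prop) q : (0 < q)%N ->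
  [pchar K].-nat q -> field_closed F -> field_closed (fun z => F (z ^+ q)).
Proof.
move=> q0 qK [F0 F1 FB FM FV]; split=> [||x y|x y|x].
- by rewrite expr0n; case: q q0 {qK}.
- by rewrite expr1n.
- move=> Fx Fy; rewrite (_ : _ ^+ q = x ^+ q - y ^+ q); first exact: FB.
  by apply/eqP; rewrite eq_sym subr_eq -exprDn_pchar // subrK.
- by rewrite exprMn; apply: FM.
- by rewrite exprVn; apply: FV.
Qed.

Theorem theorem2p5 (k : fieldType) (K : closedFieldType) (iota : {rmorphism k -> K})
  (Kalg : forall x : K, exists q : {poly k}, q != 0 /\ root (map_poly iota q) x)
  (d : int) (a : nat -> K) :
  algebraic_over_laurent iota (d, a) <->
  exists n : nat, finite_over iota (compositum_pow iota (coef_field iota a) n).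
Proof.
rewrite algebraic_over_laurentP.
have [p [p0 pk pP powE]] := pow_setP k K.
have q0 n : (0 < p ^ n)%N by rewrite expn_gt0 p0.
have qK n : [pchar K].-nat (p ^ n)%N.
  by rewrite (eq_pnat _ (fmorph_pchar iota)) pnatX pk.
split=> [[P P0 Pa]|[n /finite_overP[b bM]]].
  have Pa1 : root (map_poly (fmap iota) P) (Fps a ^+ (p ^ 0)) by [].
  have [n [Q [Qa Q'a]]] := separable_frobenius_root p0 pP P0 Pa1.
  have [g gP] := separable_root_coef Qa Q'a.
  have [b [br bg]] := kspan_ring_adjoin Kalg g.
  have bF := kspan_field_closed Kalg br.
  have bk c := kspan_ring_iota c br.
  exists n; apply/finite_overP; exists b => x; apply=> // y [[c ->] //|].
  (* The minimality of [L] is applied to the field of all [z] whose [p ^ n]-th power lies in the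
     span. *)
  move=> /powE[z Lz ->]; apply: (Lz (fun z => kspan iota b (z ^+ (p ^ n)))).
    exact: field_closed_root.
  move=> u [[c ->]|[i ->]]; first by rewrite -rmorphXn.
  (* The power [a i ^+ (p ^ n)] is the coefficient of index [i * p ^ n] of [Fps a ^+ (p ^ n)]. *)
  have := gP _ bF bk bg (i * p ^ n)%N.
  by rewrite fcoef_frobenius // dvdn_mull // mulnK.
(* The span of [b] need not be a ring, so it is enlarged to one. *)
have [b' [br bb']] := kspan_ring_adjoin Kalg b.
have bF := kspan_field_closed Kalg br.
have ba m : kspan iota b' ((Fps a ^+ (p ^ n)) m).
  rewrite fcoef_frobenius //; case: ifP => _; last exact: kspan0.
  have aM : compositum_pow iota (coef_field iota a) n (a (m %/ p ^ n)%N ^+ (p ^ n)).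
    apply: gen_field_in; right; apply/powE; exists (a (m %/ p ^ n)%N) => //.
    by apply: gen_field_in; right; exists (m %/ p ^ n)%N.
  apply: kspan_ind (bM _ aM) => //; [exact: kspan0|move=> x y; exact: kspanD|].
  by move=> c x; exact: kspanZ.
have [P [P0 Pa]] := kspan_ring_integral br ba.
(* A relation for [Fps a ^+ (p ^ n)] becomes one for [Fps a]. *)
exists (P \Po 'X^(p ^ n)).
  apply: contra_neq P0 => P0; apply/polyP => i.
  have := congr1 (fun R : {poly fps k} => R`_(i * p ^ n)) P0.
  by rewrite /= coef_comp_poly_Xn // dvdn_mull // mulnK // !coef0.
by rewrite map_comp_poly /= map_polyXn /root horner_comp hornerXn.
Qed.
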